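(* For every $n\ge 1$ let $f_n:S_n\to\{0,1\}$ be a Boolean function. Then: (1) If the sequence $\{f_n\}_{n=1}^\infty$ is noise sensitive with respect to the interchange process on the complete graph $K_n$, then it is noise sensitive with respect to the interchange process on the star graph $\mathrm{Star}_n$. (2) If the sequence $\{f_n\}_{n=1}^\infty$ is noise stable with respect to the interchange process on $\mathrm{Star}_n$, then it is noise stable with respect to the interchange process on $K_n$. Moreover, neither converse holds: for fixed $0<\varepsilon<1$, the sequence of dictator functions $\phi_n:=\mathbb 1_{\{\pi\in S_n:\ \pi(n)\le \varepsilon n\}}$ is noise sensitive with respect to the interchange process on $\mathrm{Star}_n$ but not with respect to the interchange process on $K_n$, and it is noise stable with respect to the interchange process on $K_n$ but not with respect to the interchange process on $\mathrm{Star}_n$.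
   Context: $S_n$ is the group of permutations of $[n]=\{1,\dots,n\}$ under composition. Graphs: $K_n$ has vertex set $[n]$ and edge set $\{\{i,j\}:1\le i<j\le n\}$. $\mathrm{Star}_n$ has vertex set $[n]$ and edge set $\{\{i,n\}:1\le i<n\}$. Interchange process: for a connected graph on $[n]$ with edge set $E$, the interchange process is the continuous-time Markov chain on $S_n$ with generator $(Qf)(\pi)=\nu\sum_{\{i,j\}\in E}\big(f(\pi\,(i,j))-f(\pi)\big)$, where $(i,j)$ is the transposition and $\nu>0$ is a constant rate (the same for all edges). It is reversible and irreducible with uniform stationary distribution. Relaxation time: for a reversible irreducible continuous-time Markov chain on a finite state space with generator $Q$, $t_{\rm rel}=1/\theta_1$, where $\theta_1$ is the smallest positive eigenvalue of $-Q$. Noise sensitivity/stability: let $X_n(t)$ be reversible irreducible continuous-time Markov chains on finite sets $\Omega_n$ with stationary distributions $\pi_n$ and relaxation times $t^n_{\rm rel}$, started from $X_n(0)\sim\pi_n$. A sequence $f_n:\Omega_n\to\{0,1\}$ is noise sensitive with respect to these chains if for all $\alpha>0$, $\lim_{n\to\infty}\mathrm{Cov}\big(f_n(X_n(0)),f_n(X_n(\alpha t^n_{\rm rel}))\big)=0$. It is noise stable if $\lim_{\alpha\to0}\sup_n\mathbb P\big(f_n(X_n(0))\ne f_n(X_n(\alpha t^n_{\rm rel}))\big)=0$. If $\Omega_n$ is a single point (here $n=1$), the covariance and the probability are both $0$, and $t^n_{\rm rel}$ may be given any value. *)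

(* Defs.v *)
From mathcomp Require Import all_boot all_order all_algebra all_fingroup.
From mathcomp Require Import all_classical all_reals all_analysis.
Import Order.TTheory GRing.Theory Num.Theory.
Import numFieldNormedType.Exports.

Set Implicit Arguments.
Unset Strict Implicit.
Unset Printing Implicit Defensive.

Local Open Scope classical_set_scope.
Local Open Scope ring_scope.

(* A continuous-time Markov chain on a finite set T is given by its generator
   Q, acting on functions T -> R, and its stationary distribution mu. *)
Section MarkovChain.
Context {R : realType} {T : finType}.
Variables (mu : T -> R) (Q : (T -> R) -> (T -> R)).

(* p_t(x, y) = (exp(tQ) 1_y)(x) = \sum_k t^k / k! (Q^k 1_y)(x) *)
Definition transition_prob (t : R) (x y : T) : R :=
  limn (series (fun k : nat =>
    t ^+ k / k`!%:R * iter k Q (fun z => (z == y)%:R) x)).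

(* P(X(0) = x, X(t) = y) for the chain X with X(0) ~ mu *)
Definition joint_law (t : R) (x y : T) : R := mu x * transition_prob t x y.

(* E[g(X(0), X(t))] *)
Definition expect2 (t : R) (g : T -> T -> R) : R :=
  \sum_(x : T) \sum_(y : T) joint_law t x y * g x y.

(* Cov(f(X(0)), f(X(t))) *)
Definition chain_cov (t : R) (f : T -> bool) : R :=
  expect2 t (fun x y => (f x)%:R * (f y)%:R)
  - expect2 t (fun x _ => (f x)%:R) * expect2 t (fun _ y => (f y)%:R).

(* P(f(X(0)) <> f(X(t))) *)
Definition chain_disagree (t : R) (f : T -> bool) : R :=
  expect2 t (fun x y => (f x != f y)%:R).

Definition eigenvalue_opp_generator (a : R) : Prop :=
  exists2 g : T -> R, (exists x, g x != 0) & forall x, - Q g x = a * g x.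

Definition is_smallest_pos_eigenvalue (a : R) : Prop :=
  [/\ 0 < a, eigenvalue_opp_generator a
    & forall b, 0 < b -> eigenvalue_opp_generator b -> a <= b].

(* If -Q has no positive eigenvalue (one-point state space), the value is
   irrelevant. *)
Definition relaxation_time : R :=
  (get [set a | is_smallest_pos_eigenvalue a])^-1.

End MarkovChain.

Section Noise.
Context {R : realType} {T : nat -> finType}.
Variables (mu : forall n, T n -> R)
  (Q : forall n, (T n -> R) -> (T n -> R)) (f : forall n, T n -> bool).

Definition noise_sensitive : Prop :=
  forall alpha : R, 0 < alpha ->
    chain_cov (@mu n) (@Q n) (alpha * relaxation_time (@Q n)) (@f n)
      @[n --> \oo] --> (0 : R).

Definition noise_stable : Prop :=
  ereal_sup (range (fun n : nat =>
    (chain_disagree (@mu n) (@Q n) (alpha * relaxation_time (@Q n))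
       (@f n))%:E)) @[alpha --> (0 : R)^'+] --> (0%E : \bar R).

End Noise.

(* In MathComp (s * t)%g means "s, then t", so the composition of functions
   written pi (i,j) is (tperm i j * pi)%g : it swaps the values of pi at the
   positions i and j. *)
Definition interchange_generator {R : realType} (nu : R) {n : nat}
    (e : rel 'I_n) (g : 'S_n -> R) (s : 'S_n) : R :=
  nu * \sum_(i < n) \sum_(j < n | (i < j)%N && e i j)
         (g (tperm i j * s)%g - g s).

Definition uniform_dist {R : realType} {T : finType} (_ : T) : R :=
  #|T|%:R^-1.

Definition complete_edge (n : nat) : rel 'I_n := fun i j => i != j.

(* Vertices are 0, ..., n in place of 1, ..., n + 1, so the centre, which is
   the last vertex, is ord_max. *)
Definition star_edge (n : nat) : rel 'I_n.+1 :=
  fun i j => (i != j) && ((i == ord_max) || (j == ord_max)).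

(* Sequences indexed by n >= 1 are shifted: the term of index n : nat lives on
   the symmetric group on n.+1 points, so that n = 0 is the one-point case. *)
Section Interchange.
Context {R : realType}.
Variables (nu : R) (f : forall n, 'S_n.+1 -> bool).

Definition noise_sensitive_complete : Prop :=
  noise_sensitive (fun n => @uniform_dist R 'S_n.+1)
    (fun n => interchange_generator nu (@complete_edge n.+1)) f.

Definition noise_sensitive_star : Prop :=
  noise_sensitive (fun n => @uniform_dist R 'S_n.+1)
    (fun n => interchange_generator nu (@star_edge n)) f.

Definition noise_stable_complete : Prop :=
  noise_stable (fun n => @uniform_dist R 'S_n.+1)
    (fun n => interchange_generator nu (@complete_edge n.+1)) f.

Definition noise_stable_star : Prop :=
  noise_stable (fun n => @uniform_dist R 'S_n.+1)
    (fun n => interchange_generator nu (@star_edge n)) f.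

End Interchange.

(* pi(n + 1) <= eps (n + 1); values are shifted down by one in 'I_n.+1. *)
Definition dictator {R : realType} (eps : R) (n : nat) (s : 'S_n.+1) : bool :=
  (s ord_max).+1%:R <= eps * n.+1%:R.

(* Main.v *)
Require Import Defs.
From HB Require Import structures.
From mathcomp Require Import all_boot all_order all_algebra all_fingroup.
From mathcomp Require Import all_classical all_reals all_analysis.
From mathcomp Require Import ring lra zify.
Import Order.TTheory GRing.Theory Num.Theory.
Import numFieldNormedType.Exports.

(** The complete graph on m points has the larger Dirichlet form, but only by a
    factor of order m, and m is exactly the ratio of the two time scales.

    Write L_K and L_S for the sums of (1 - tau) over all transpositions tau,
    respectively over the transpositions with the centre c.  Since
    (i j) = (i c)(j c)(i c), one has L_K <= (9/2) m L_S as quadratic forms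
    ([star_complete_dirichlet_le]).  The relaxation time on the complete graph
    is 1 / (nu m), and on the star it is at least 1 / (2 nu), so after both
    processes have been run for a multiple of their relaxation times the star
    has decorrelated at least as much as the complete graph, up to a universal
    constant in the multiple.  Conjugation permutes the transpositions, hence
    L_K commutes with everything generated by left translations, in particular
    with L_S; for commuting symmetric generators an inequality between
    quadratic forms passes to the semigroups ([inner_heat_le]).  This gives
    <f, exp(-t L_S) f> <= <f, exp(-t' L_K) f> for the relevant times
    ([correlation_star_le]).  Both the covariance and the disagreement
    probability are affine functions of this correlation, increasing and
    decreasing respectively, and the two implications follow.

    The spectral gap of the complete graph ([complete_eigenvalue_ge]) comes from
    a highest weight argument.  Inside an eigenspace of L_K choose a set B of
    positions, maximal among those for which some nonzero eigenvector h is
    invariant under all transpositions inside B.  For k outside B, summing h over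
    the transpositions (i k) with i in B or i = k makes it invariant on B + k,
    so this sum vanishes; the edges between B and its complement then contribute
    exactly (m - #|B|) (#|B| + 1) >= m to the eigenvalue, and all other
    edges contribute a nonnegative amount.  For the star an eigenfunction with
    eigenvalue at most 2 nu is enough ([relaxation_time_star_ge]).

    A function of the value at the centre, once centred, is an eigenfunction of
    both generators with the same eigenvalue nu m.  On the scale 1 / (nu m) of
    the complete graph a dictator therefore decorrelates like exp(-alpha),
    while on the scale 1 / nu of the star it does so like exp(-m alpha), or
    exp(-m alpha / 2) with the bound used here; as the
    variance tends to eps (1 - eps) > 0, the counterexamples follow. *)

Set Implicit Arguments.
Unset Strict Implicit.
Unset Printing Implicit Defensive.

Local Open Scope classical_set_scope.
Local Open Scope ring_scope.

(** * The semigroup generated by a linear operator on a finite set *)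

Section HeatSemigroup.
Context {R : realType} {T : finType}.
Implicit Types (f g : T -> R) (Q : {linear (T -> R) -> (T -> R)}).

Definition inner f g : R := \sum_x f x * g x.

(** exp(tQ) g.  At the indicator of a point y this is the transition
    probability to y, by definition. *)
Definition heat Q (t : R) g (x : T) : R :=
  limn (series (fun k : nat => t ^+ k / k`!%:R * iter k Q g x)).

Lemma scalefE (a : R) g x : (a *: g) x = a * g x. Proof. by []. Qed.

Lemma scalerE (a b : R) : a *: b = a * b. Proof. by []. Qed.

Lemma fun_sum_delta g : g = \sum_y g y *: (fun z => (z == y)%:R).
Proof.
apply/funext => x; rewrite fct_sumE (bigD1 x)//= big1 ?addr0.
  by rewrite scalefE eqxx mulr1.
by move=> y yx; rewrite scalefE eq_sym (negbTE yx) mulr0.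
Qed.

Lemma linear_kernel Q g x : Q g x = \sum_y g y * Q (fun z => (z == y)%:R) x.
Proof.
rewrite {1}(fun_sum_delta g) linear_sum fct_sumE; apply: eq_bigr => y _.
by rewrite linearZ.
Qed.

(** A geometric bound on the iterates is all that convergence of the
    exponential series needs. *)
Lemma iter_bound Q g : exists2 C : R, 0 <= C &
  exists2 M : R, 0 <= M & forall k x, `|iter k Q g x| <= C ^+ k * M.
Proof.
exists (\sum_x \sum_y `|Q (fun z => (z == y)%:R) x|).
  by apply: sumr_ge0 => x _; apply: sumr_ge0 => y _.
exists (\sum_x `|g x|); first exact: sumr_ge0.
elim => [|k IH] x.
  by rewrite mul1r (bigD1 x)//= lerDl sumr_ge0.
set C := (\sum_x _ : R) in IH *; set M := (\sum_x _ : R) in IH *.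
have C0 : 0 <= C by apply: sumr_ge0 => y _; apply: sumr_ge0.
have M0 : 0 <= M by apply: sumr_ge0.
rewrite iterS linear_kernel (le_trans (ler_norm_sum _ _ _))// exprS -mulrA.
apply: le_trans (_ : (\sum_y `|Q (fun z => (z == y)%:R) x|) * (C ^+ k * M) <= _).
  by rewrite mulr_suml ler_sum// => y _; rewrite normrM mulrC ler_wpM2l.
rewrite ler_wpM2r ?mulr_ge0 ?exprn_ge0//.
by rewrite /C [leRHS](bigD1 x)//= lerDl; apply: sumr_ge0 => y _; apply: sumr_ge0.
Qed.

Lemma cvg_heat Q g x t :
  cvgn (series (fun k : nat => t ^+ k / k`!%:R * iter k Q g x)).
Proof.
have [C C0 [M M0 bnd]] := iter_bound Q g.
apply: normed_cvg.
have eE n : (M *: exp_coeff (`|t| * C)) n = M * ((`|t| * C) ^+ n / n`!%:R).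
  by [].
apply: (@series_le_cvg _ _ (M *: exp_coeff (`|t| * C))) => [n|n|n|].
- exact: normr_ge0.
- by rewrite eE !mulr_ge0// exprn_ge0 ?mulr_ge0.
- rewrite eE /= !normrM normrX (ger0_norm (x := _^-1))//.
  rewrite (le_trans (ler_wpM2l _ (bnd _ _)))// ?mulr_ge0 ?exprn_ge0//.
  by rewrite le_eqVlt; apply/orP; left; apply/eqP; rewrite exprMn; ring.
apply: is_cvg_seriesZ.
exact: is_cvg_series_exp_coeff.
Qed.

Lemma heat_cvg Q g x t :
  series (fun k : nat => t ^+ k / k`!%:R * iter k Q g x) @ \oo --> heat Q t g x.
Proof. exact: cvg_heat. Qed.

(** The exponential series may be paired with f termwise.  Identities
    between linear functionals of exp(tQ) g thereby reduce to identities
    between functionals of the iterates of Q. *)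
Lemma inner_heat Q f g t :
  series (fun k : nat => t ^+ k / k`!%:R * inner f (iter k Q g)) @ \oo -->
  inner f (heat Q t g).
Proof.
have -> : series (fun k : nat => t ^+ k / k`!%:R * inner f (iter k Q g)) =
  fun n => \sum_x f x * series (fun k => t ^+ k / k`!%:R * iter k Q g x) n.
  apply/funext => n; rewrite /series/=.
  under [RHS]eq_bigr => x _ do rewrite mulr_sumr.
  rewrite exchange_big; apply: eq_bigr => k _; rewrite /inner mulr_sumr.
  by apply: eq_bigr => x _; rewrite mulrCA.
apply: cvg_big => [|x _]; first exact: add_continuous.
apply: cvgM; [exact: cvg_cst|exact: heat_cvg].
Qed.

Lemma heat_is_linear Q t : linear (heat Q t).
Proof.
move=> a f g; apply/funext => x.
have iterL k : iter k Q (a *: f + g) = a *: iter k Q f + iter k Q g.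
  by elim: k => // k IH; rewrite !iterS IH linearP.
rewrite [RHS](_ : _ = a * heat Q t f x + heat Q t g x)//.
apply: cvg_lim => //.
rewrite (_ : series _ = fun n =>
    a * series (fun k => t ^+ k / k`!%:R * iter k Q f x) n
    + series (fun k => t ^+ k / k`!%:R * iter k Q g x) n).
  by apply: cvgD; [apply: cvgM; [exact: cvg_cst|]|]; exact: heat_cvg.
apply/funext => n; rewrite /series/= mulr_sumr -big_split; apply: eq_bigr => k _.
rewrite iterL /= (_ : (a *: _ + _) x = a * iter k Q f x + iter k Q g x)//.
by rewrite mulrDr mulrCA.
Qed.

HB.instance Definition _ Q t :=
  GRing.isLinear.Build R (T -> R) (T -> R) *:%R (heat Q t) (heat_is_linear Q t).

Lemma heat0 Q g : heat Q 0 g = g.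
Proof.
apply/funext => x; apply: cvg_lim => //.
apply: (@cvg_near_cst _ _ (g x)); near=> n.
rewrite /series/= big_mkord.
have n0 : (0 < n)%N by near: n; exists 1%N.
rewrite (bigD1 (Ordinal n0))//= expr0 fact0 divr1 mul1r big1 ?addr0//.
move=> i /negbTE i0; rewrite expr0n (_ : (_ == _) = false) ?mul0r// -i0.
Unshelve. all: by end_near. Qed.

Lemma heat_eigen Q t a g : Q g = a *: g -> heat Q t g = expR (a * t) *: g.
Proof.
move=> Qg; apply/funext => x.
have iterE k : iter k Q g = a ^+ k *: g.
  elim: k => [|k IH]; first by rewrite scale1r.
  by rewrite iterS IH linearZ/= Qg scalerA exprSr.
rewrite scalefE mulrC; apply: cvg_lim => //.
rewrite (_ : series _ = fun n => g x * series (exp_coeff (a * t)) n).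
  apply: cvgM; [exact: cvg_cst|]; exact: is_cvg_series_exp_coeff.
apply/funext => n; rewrite /series/= mulr_sumr; apply: eq_bigr => k _.
by rewrite iterE scalefE /exp_coeff/= exprMn; ring.
Qed.

(** Operators commuting with Q commute with exp(tQ).  Taking Q itself for B
    turns the derivative of [heat_derive] into Q (exp(tQ) g). *)
Lemma heat_commute Q (B : {linear (T -> R) -> (T -> R)}) t g :
  (forall h, B (Q h) = Q (B h)) -> B (heat Q t g) = heat Q t (B g).
Proof.
move=> BQ; have Biter k h : B (iter k Q h) = iter k Q (B h).
  by elim: k => // k IH; rewrite !iterS BQ IH.
apply/funext => x.
pose c y := B (fun z => (z == y)%:R) x.
have BE h : B h x = inner c h.
  by rewrite linear_kernel; apply: eq_bigr => y _; rewrite mulrC.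
rewrite BE; apply/esym/cvg_lim => //.
rewrite (_ : series _ =
    series (fun k => t ^+ k / k`!%:R * inner c (iter k Q g))).
  exact: inner_heat.
by congr series; apply/funext => k; rewrite -Biter BE.
Qed.

Definition symmetric_op Q := forall f g, inner (Q f) g = inner f (Q g).

Lemma innerC f g : inner f g = inner g f.
Proof. by apply: eq_bigr => x _; rewrite mulrC. Qed.

Lemma heat_symmetric Q t : symmetric_op Q ->
  forall f g, inner (heat Q t f) g = inner f (heat Q t g).
Proof.
move=> sQ f g.
have iter_sym k : inner g (iter k Q f) = inner f (iter k Q g).
  elim: k f g => [|k IH] f' g'; first exact: innerC.
  by rewrite iterSr IH sQ.
rewrite innerC; have /cvg_lim <- // := @inner_heat Q g f t.
rewrite (_ : series _ =
    series (fun k => t ^+ k / k`!%:R * inner f (iter k Q g))).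
  by apply: cvg_lim => //; exact: inner_heat.
by congr series; apply/funext => k; rewrite iter_sym.
Qed.

(** Each coordinate of exp(tQ) g is an everywhere convergent power series
    in t, and differentiating it termwise shifts the iterates of Q by one. *)
Lemma heat_derive Q g x (t : R) :
  is_derive t (1 : R) (fun s => heat Q s g x) (heat Q t (Q g) x).
Proof.
pose c h k := (k`!%:R)^-1 * iter k Q h x.
have cE h s : heat Q s h x = limn (pseries (c h) s).
  rewrite /heat /pseries; congr (limn (series _)); apply/funext => k.
  by rewrite /= /c [RHS]mulrAC (mulrC (s ^+ k)).
have dc h : pseries_diffs (c h) = c (Q h).
  apply/funext => k; rewrite /pseries_diffs /c mulrA -iterSr; congr (_ * _).
  by rewrite factS natrM invfM mulVKf.
have cvgc h s : cvgn (pseries (c h) s).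
  rewrite /pseries (_ : (fun _ => _) = fun k => s ^+ k / k`!%:R * iter k Q h x).
    exact: cvg_heat.
  by apply/funext => k; rewrite /= /c [in LHS]mulrAC (mulrC (s ^+ k)).
rewrite (_ : (fun s => _) = fun s => limn (pseries (c g) s)); last first.
  by apply/funext => s; rewrite cE.
rewrite cE -dc; apply: (@pseries_snd_diffs _ _ (`|t| + 1)); rewrite ?dc//.
by rewrite [ltRHS]ger0_norm ?addr_ge0// ltrDl.
Qed.

(** Product rule for two commuting semigroups at affine times.  It replaces
    the identity exp(A) exp(B) = exp(A + B): both the semigroup property and
    the comparison of semigroups come from following such a product along a
    suitable path of times. *)
Lemma heat2_derive (Qa Qb : {linear (T -> R) -> (T -> R)}) a0 a1 b0 b1 f x s :
  (forall h, Qb (Qa h) = Qa (Qb h)) ->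
  let v s := heat Qa (a0 + a1 * s) (heat Qb (b0 + b1 * s) f) in
  is_derive s (1 : R) (fun s => v s x) ((a1 *: Qa (v s) + b1 *: Qb (v s)) x).
Proof.
move=> QC v.
pose d y : T -> R := fun z => (z == y)%:R.
have aff (c0 c1 : R) : is_derive s (1 : R) (fun s => c0 + c1 * s) c1.
  rewrite (_ : (fun _ => _) = cst c0 + c1 *: id)//.
  by apply: is_derive_eq; rewrite add0r /GRing.scale/= mulr1.
have dcomp (Q : {linear (T -> R) -> (T -> R)}) (c0 c1 : R) h y :
    is_derive s (1 : R) (fun s => heat Q (c0 + c1 * s) h y)
      (heat Q (c0 + c1 * s) (Q h) y * c1).
  exact: (@is_derive1_comp _ (fun s => heat Q s h y) (fun s => c0 + c1 * s) s _ _
    (heat_derive _ _ _ _) (aff _ _)).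
pose A y := fun s => heat Qb (b0 + b1 * s) f y.
pose B y := fun s => heat Qa (a0 + a1 * s) (d y) x.
have vE : (fun s => v s x) = \sum_y (A y * B y).
  by apply/funext => u; rewrite fct_sumE /v linear_kernel.
have dvE : (a1 *: Qa (v s) + b1 *: Qb (v s)) x = \sum_y
    (A y s *: (heat Qa (a0 + a1 * s) (Qa (d y)) x * a1)
     + B y s *: (heat Qb (b0 + b1 * s) (Qb f) y * b1)).
  rewrite big_split/=; congr (_ + _).
    rewrite scalefE -[Qa _]/((Qa \o heat Qa (a0 + a1 * s)) _).
    rewrite linear_kernel mulr_sumr.
    by apply: eq_bigr => y _; rewrite /= heat_commute// scalerE mulrCA (mulrC a1).
  rewrite scalefE heat_commute// heat_commute// linear_kernel mulr_sumr.
  by apply: eq_bigr => y _; rewrite scalerE mulrC mulrAC mulrC.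
rewrite vE dvE.
elim/big_ind2 : _ => [|f1 f1' f2 f2' ? ?|y _].
- exact: is_derive_cst.
- exact: is_deriveD.
- by apply: is_deriveM; exact: dcomp.
Qed.

End HeatSemigroup.

(** * Comparison of commuting symmetric semigroups *)

Section Comparison.
Context {R : realType} {T : finType}.
Implicit Types (f g h : T -> R) (Q : {linear (T -> R) -> (T -> R)}).

(** Along u |-> exp((s - u) Q) exp((t + u) Q) f the derivative vanishes. *)
Lemma heat_add Q s t f : heat Q s (heat Q t f) = heat Q (s + t) f.
Proof.
apply/funext => x.
pose v u := heat Q (s + -1 * u) (heat Q (t + 1 * u) f).
have : v 0 x = v s x.
  apply: (@is_derive_0_is_cst _ (fun u => v u x)) => u.
  have := @heat2_derive _ _ Q Q s (-1) t 1 f x u (fun=> erefl).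
  by cbv zeta; rewrite scale1r scaleN1r addNr.
by rewrite /v !mulr0 !addr0 mul1r mulN1r subrr heat0 addrC.
Qed.

Lemma inner_ge0 f : 0 <= inner f f.
Proof. by apply: sumr_ge0 => x _; rewrite -expr2 sqr_ge0. Qed.

Lemma inner_heat_half Q t f : symmetric_op Q ->
  inner f (heat Q t f) = inner (heat Q (t / 2) f) (heat Q (t / 2) f).
Proof. by move=> sQ; rewrite heat_symmetric// heat_add -splitr. Qed.

Lemma innerDr f g h : inner f (g + h) = inner f g + inner f h.
Proof.
by rewrite /inner -big_split; apply: eq_bigr => x _; rewrite mulrDr.
Qed.

Lemma innerZr a f g : inner f (a *: g) = a * inner f g.
Proof.
by rewrite /inner mulr_sumr; apply: eq_bigr => x _; rewrite scalefE mulrCA.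
Qed.

Lemma innerDl f g h : inner (f + g) h = inner f h + inner g h.
Proof. by rewrite !(innerC _ h) innerDr. Qed.

Lemma innerZl a f g : inner (a *: f) g = a * inner f g.
Proof. by rewrite !(innerC _ g) innerZr. Qed.

(** Interpolate from exp((a/2) Qa) f to exp((b/2) Qb) f by
    v(s) = exp((1 - s) (a/2) Qa) exp(s (b/2) Qb) f.  Since the generators
    commute, v' = (b/2 Qb - a/2 Qa) v, and the squared norm of v has derivative
    b <v, Qb v> - a <v, Qa v> >= 0.  Halving the times turns the correlation
    <f, exp(a Qa) f> into a squared norm, so no simultaneous diagonalization is
    required. *)
Lemma inner_heat_le (Qa Qb : {linear (T -> R) -> (T -> R)}) a b f :
  symmetric_op Qa -> symmetric_op Qb -> (forall h, Qb (Qa h) = Qa (Qb h)) ->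
  (forall h, a * inner h (Qa h) <= b * inner h (Qb h)) ->
  inner f (heat Qa a f) <= inner f (heat Qb b f).
Proof.
move=> sa sb QC le_ab; rewrite !inner_heat_half//.
pose v s := heat Qa (a / 2 + - (a / 2) * s) (heat Qb (0 + b / 2 * s) f).
pose phi s := inner (v s) (v s).
have v0 : v 0 = heat Qa (a / 2) f by rewrite /v !mulr0 !addr0 heat0.
have v1 : v 1 = heat Qb (b / 2) f.
  by rewrite /v !mulr1 subrr add0r heat0.
rewrite -v0 -v1 -!/(phi _).
pose dv s := - (a / 2) *: Qa (v s) + b / 2 *: Qb (v s).
have dphi s : is_derive s (1 : R) phi (2 * inner (v s) (dv s)).
  rewrite (_ : phi = \sum_x ((fun s => v s x) * (fun s => v s x))); last first.
    by apply/funext => u; rewrite fct_sumE.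
  rewrite (_ : 2 * _ = \sum_x (v s x *: dv s x + v s x *: dv s x)); last first.
    rewrite /inner mulr_sumr; apply: eq_bigr => x _.
    by rewrite scalerE -mulr2n mulr_natl.
  elim/big_ind2 : _ => [|f1 f1' f2 f2' ? ?|y _].
  - exact: is_derive_cst.
  - exact: is_deriveD.
  - by apply: is_deriveM; exact: heat2_derive.
have dphi1 s : derivable phi s 1 by case: (dphi s).
apply: (@ger0_derive1_ndecr _ phi 0 1) => //.
- move=> s _; rewrite derive1E derive_val innerDr !innerZr.
  have := le_ab (v s); lra.
- by apply: derivable_within_continuous => s _.
Qed.

End Comparison.

(** * Covariance and disagreement as quadratic forms *)

Section Covariance.
Context {R : realType} {T : finType}.
Implicit Types (f : T -> bool) (Q : {linear (T -> R) -> (T -> R)}).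

Definition indic_fun f : T -> R := fun x => (f x)%:R.

Definition mean (g : T -> R) : R := #|T|%:R^-1 * \sum_x g x.

(** E[f(X(0)) f(X(t))] under the uniform law, as [chain_covE] shows. *)
Definition correlation Q (t : R) f : R :=
  #|T|%:R^-1 * inner (indic_fun f) (heat Q t (indic_fun f)).

Lemma expect2M Q t (g h : T -> R) :
  expect2 (@uniform_dist R T) Q t (fun x y => g x * h y) =
  #|T|%:R^-1 * inner g (heat Q t h).
Proof.
rewrite /expect2 /inner mulr_sumr; apply: eq_bigr => x _.
rewrite linear_kernel !mulr_sumr; apply: eq_bigr => y _.
rewrite /joint_law /uniform_dist -[transition_prob _ _ _ _]/(heat Q t _ x).
by rewrite -!mulrA; congr (_ * _); rewrite mulrCA; congr (_ * _); rewrite mulrC.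
Qed.

Hypothesis (T0 : (0 < #|T|)%N).
Variables (Q : {linear (T -> R) -> (T -> R)}) (sQ : symmetric_op Q).
Hypothesis (Q1 : Q (cst 1) = 0).

Lemma heat_cst1 t : heat Q t (cst 1) = cst 1.
Proof.
by rewrite (@heat_eigen _ _ _ _ 0) ?mul0r ?expR0 ?scale1r// Q1 scale0r.
Qed.

Lemma expect2l t (g : T -> R) :
  expect2 (@uniform_dist R T) Q t (fun x y => g x) = mean g.
Proof.
rewrite (_ : (fun x y => g x) = fun x y => g x * (cst 1 : T -> R) y).
  rewrite expect2M heat_cst1 /inner /mean; congr (_ * _).
  by apply: eq_bigr => x _; rewrite mulr1.
by apply/funext => x; apply/funext => y; rewrite mulr1.
Qed.

Lemma expect2r t (g : T -> R) :
  expect2 (@uniform_dist R T) Q t (fun x y => g y) = mean g.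
Proof.
rewrite (_ : (fun x y => g y) = fun x y => (cst 1 : T -> R) x * g y).
  rewrite expect2M -heat_symmetric// heat_cst1 /inner /mean; congr (_ * _).
  by apply: eq_bigr => x _; rewrite mul1r.
by apply/funext => x; apply/funext => y; rewrite mul1r.
Qed.

Lemma chain_covE t f : chain_cov (@uniform_dist R T) Q t f =
  correlation Q t f - mean (indic_fun f) ^+ 2.
Proof.
rewrite /chain_cov (expect2l t (indic_fun f)) (expect2r t (indic_fun f)).
by rewrite (expect2M Q t (indic_fun f) (indic_fun f)) expr2.
Qed.

Lemma chain_disagreeE t f : chain_disagree (@uniform_dist R T) Q t f =
  2 * (mean (indic_fun f) - correlation Q t f).
Proof.
have <- := expect2l t (indic_fun f).
have := expect2r t (indic_fun f); rewrite -(expect2l t) => eqlr.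
rewrite /correlation -expect2M mulrBr {1}[2 * expect2 _ _ _ _]mulr_natl mulr2n.
rewrite -{2}eqlr /chain_disagree /expect2 mulr_sumr -big_split -sumrB.
apply: eq_bigr => x _; rewrite /= mulr_sumr -big_split -sumrB.
apply: eq_bigr => y _ /=; rewrite /indic_fun.
by case: (f x); case: (f y) => /=; ring.
Qed.

Definition centered f : T -> R :=
  indic_fun f - mean (indic_fun f) *: cst 1.

Let N0 : #|T|%:R != 0 :> R.
Proof. by rewrite pnatr_eq0 -lt0n. Qed.

Lemma inner_cst1 (h : T -> R) : inner (cst 1) h = #|T|%:R * mean h.
Proof.
by rewrite /mean mulrA divff// mul1r; apply: eq_bigr => x _; exact: mul1r.
Qed.

Lemma mean_cst1 : mean (cst 1) = 1.
Proof. by rewrite /mean sumr_const mulVf. Qed.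

Lemma mean_centered f : inner (cst 1) (centered f) = 0.
Proof.
rewrite /centered -scaleNr innerDr innerZr !inner_cst1 mean_cst1.
by rewrite mulr1 mulNr mulrC subrr.
Qed.

Lemma indic_centered f :
  indic_fun f = mean (indic_fun f) *: cst 1 + centered f.
Proof. by rewrite /centered addrC subrK. Qed.

(** Constants are fixed by the semigroup and orthogonal to centred functions,
    so the squared mean splits off. *)
Lemma correlation_centered t f : correlation Q t f =
  mean (indic_fun f) ^+ 2 + #|T|%:R^-1 * inner (centered f) (heat Q t (centered f)).
Proof.
have fE := indic_centered f; rewrite /correlation.
set m := mean _ in fE *; set g := centered f in fE *.
rewrite fE linearD linearZ/= heat_cst1.
rewrite innerDl !innerDr !innerZl !innerZr -(heat_symmetric t sQ) heat_cst1.
rewrite mean_centered (innerC g) mean_centered inner_cst1 mean_cst1.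
by field.
Qed.

Lemma mean_sqr_le_correlation t f :
  mean (indic_fun f) ^+ 2 <= correlation Q t f.
Proof.
by rewrite correlation_centered lerDl mulr_ge0// inner_heat_half// inner_ge0.
Qed.

Lemma correlation_eigen lambda t f :
  Q (indic_fun f) = - lambda *: centered f ->
  correlation Q t f = mean (indic_fun f) ^+ 2 +
    expR (- lambda * t) * (mean (indic_fun f) - mean (indic_fun f) ^+ 2).
Proof.
move=> Qf; rewrite correlation_centered; congr (_ + _).
have Qg : Q (centered f) = - lambda *: centered f.
  by rewrite {1}/centered linearB linearZ/= Q1 scaler0 subr0.
rewrite (heat_eigen _ Qg) innerZr mulrCA; congr (_ * _).
rewrite {1}/centered -scaleNr innerDl innerZl mean_centered mulr0 addr0.
rewrite /centered -scaleNr innerDr innerZr mulrDr (innerC _ (cst 1)) inner_cst1.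
congr (_ + _).
  rewrite /mean; congr (_ * _); apply: eq_bigr => x _.
  by rewrite /indic_fun; case: (f x); rewrite ?mulr1 ?mulr0.
by rewrite mulrA; field.
Qed.

End Covariance.

(** * Interchange generators and their Dirichlet forms *)

Section Interchange.
Context {R : realType} {n : nat}.
Implicit Types (g h : 'S_n -> R) (s : 'S_n) (nu : R) (e : rel 'I_n).

Lemma interchange_is_linear nu e : linear (@interchange_generator R nu n e).
Proof.
move=> a g h; apply/funext => s.
rewrite [RHS](_ : _ = a * interchange_generator nu e g s
                      + interchange_generator nu e h s)//.
rewrite /interchange_generator mulrCA -mulrDr; congr (_ * _).
rewrite mulr_sumr -big_split; apply: eq_bigr => i _; rewrite mulr_sumr -big_split.
apply: eq_bigr => j _ /=.
by rewrite -[(a *: g + h) _]/(a * g _ + h _) -[(a *: g + h) _]/(a * g _ + h _); ring.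
Qed.

HB.instance Definition _ nu e :=
  GRing.isLinear.Build R ('S_n -> R) ('S_n -> R) *:%R
    (@interchange_generator R nu n e) (interchange_is_linear nu e).

(** Twice the Dirichlet form of the translation by s alone. *)
Definition diff_energy s g : R := \sum_p (g p - g (s * p)%g) ^+ 2.

Lemma diff_energy_ge0 s g : 0 <= diff_energy s g.
Proof. by apply: sumr_ge0 => p _; exact: sqr_ge0. Qed.

Lemma reindex_mulg s (F : 'S_n -> R) : \sum_p F (s * p)%g = \sum_p F p.
Proof. by rewrite [RHS](reindex_inj (mulgI s)). Qed.

Lemma interchange_symmetric nu e :
  symmetric_op (@interchange_generator R nu n e).
Proof.
move=> f g; rewrite /inner /interchange_generator.
under eq_bigr => p _ do rewrite -mulrA mulr_suml.
under [RHS]eq_bigr => p _ do rewrite mulrCA mulr_sumr.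
rewrite -!mulr_sumr; congr (_ * _).
rewrite exchange_big [RHS]exchange_big; apply: eq_bigr => i _ /=.
under eq_bigr => p _ do rewrite mulr_suml.
under [RHS]eq_bigr => p _ do rewrite mulr_sumr.
rewrite exchange_big [RHS]exchange_big; apply: eq_bigr => j _ /=.
under eq_bigr => p _ do rewrite mulrBl.
under [RHS]eq_bigr => p _ do rewrite mulrBr.
rewrite !sumrB; congr (_ - _).
rewrite -(reindex_mulg (tperm i j)); apply: eq_bigr => p _.
by rewrite mulgA tperm2 mul1g.
Qed.

Lemma interchange_cst1 nu e : @interchange_generator R nu n e (cst 1) = 0.
Proof.
apply/funext => s; rewrite /interchange_generator big1 ?mulr0// => i _.
by rewrite big1// => j _; rewrite subrr.
Qed.

Lemma inner_interchange nu e g :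
  2 * inner g (interchange_generator nu e g) =
  - (nu * \sum_(i < n) \sum_(j < n | (i < j)%N && e i j)
       diff_energy (tperm i j) g).
Proof.
rewrite /inner /interchange_generator.
under eq_bigr => p _ do rewrite mulrCA mulr_sumr.
rewrite -mulr_sumr mulrCA -mulrN; congr (_ * _).
rewrite exchange_big mulr_sumr -sumrN; apply: eq_bigr => i _ /=.
under eq_bigr => p _ do rewrite mulr_sumr.
rewrite exchange_big mulr_sumr -sumrN; apply: eq_bigr => j _ /=.
have sq : \sum_p g (tperm i j * p)%g ^+ 2 = \sum_p g p ^+ 2.
  exact: (reindex_mulg _ (fun p => g p ^+ 2)).
apply/eqP; rewrite -subr_eq0 opprK mulr_sumr -big_split/=; apply/eqP.
rewrite (eq_bigr (fun p => g (tperm i j * p)%g ^+ 2 - g p ^+ 2)).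
  by rewrite sumrB sq subrr.
by move=> p _; ring.
Qed.

(** Unordered edges of the complete graph are traded for ordered pairs, on
    which permutations act by reindexing. *)
Lemma sum_lt_sym (F : 'I_n -> 'I_n -> R) :
  (forall i j, F i j = F j i) -> (forall i, F i i = 0) ->
  2 * \sum_(i < n) \sum_(j < n | (i < j)%N) F i j = \sum_i \sum_j F i j.
Proof.
move=> Fsym F0.
have -> : \sum_i \sum_j F i j =
    \sum_(i < n) \sum_(j < n | (i < j)%N) F i j +
    \sum_(i < n) \sum_(j < n | (j < i)%N) F i j.
  rewrite -big_split; apply: eq_bigr => i _ /=.
  rewrite (bigID (fun j : 'I_n => (i < j)%N))/=; congr (_ + _).
  rewrite (bigD1 i) ?ltnn//= F0 add0r; apply: eq_bigl => j.
  by rewrite -leqNgt ltn_neqAle andbC.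
rewrite [X in _ + X](exchange_big_dep xpredT)//= mulr_natl mulr2n; congr (_ + _).
by apply: eq_bigr => i _; apply: eq_bigr => j _; rewrite Fsym.
Qed.

Lemma complete_pred (i j : 'I_n) : (i < j)%N && complete_edge i j = (i < j)%N.
Proof.
by rewrite /complete_edge; case: ltngtP => // ij; rewrite neq_ltn ij.
Qed.

Lemma complete_generatorE nu g p :
  2 * interchange_generator nu (@complete_edge n) g p =
  nu * \sum_i \sum_j (g (tperm i j * p)%g - g p).
Proof.
rewrite /interchange_generator mulrCA -sum_lt_sym.
- do 2 congr (_ * _); apply: eq_bigr => i _.
  by apply: eq_bigl => j; rewrite complete_pred.
- by move=> i j; rewrite tpermC.
- by move=> i; rewrite tperm1 mul1g subrr.
Qed.

Lemma inner_complete nu g :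
  4 * inner g (interchange_generator nu (@complete_edge n) g) =
  - (nu * \sum_i \sum_j diff_energy (tperm i j) g).
Proof.
rewrite (_ : 4 = 2 * 2); last by ring.
rewrite -mulrA inner_interchange -sum_lt_sym; first last.
- by move=> i; rewrite /diff_energy big1// => p _; rewrite tperm1 mul1g subrr expr0n.
- by move=> i j; rewrite tpermC.
rewrite mulrN mulrCA; do 3 congr (_ _).
by apply: eq_bigr => i _; apply: eq_bigl => j; rewrite complete_pred.
Qed.

(** The set of all transpositions is stable under conjugation, so the complete
    generator commutes with left translations, and hence with every
    interchange generator. *)
Lemma complete_shift nu g s p :
  interchange_generator nu (@complete_edge n) (fun q => g (s * q)%g) p =
  interchange_generator nu (@complete_edge n) g (s * p)%g.
Proof.
apply: (@mulfI _ 2); first by rewrite pnatr_eq0.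
rewrite !complete_generatorE; congr (_ * _).
rewrite (reindex_inj (@perm_inj _ s)); apply: eq_bigr => i _ /=.
rewrite (reindex_inj (@perm_inj _ s)); apply: eq_bigr => j _ /=.
by rewrite -tpermJ /conjg !mulgA mulgV mul1g.
Qed.

Lemma complete_commute nu nu' e g :
  interchange_generator nu (@complete_edge n) (interchange_generator nu' e g) =
  interchange_generator nu' e (interchange_generator nu (@complete_edge n) g).
Proof.
have {1}-> : interchange_generator nu' e g = nu' *: (\sum_(i < n)
    \sum_(j < n | (i < j)%N && e i j) ((fun q => g (tperm i j * q)%g) - g)).
  apply/funext => p; rewrite scalefE fct_sumE; congr (_ * _).
  by apply: eq_bigr => i _; rewrite fct_sumE.
rewrite linearZ/= linear_sum; apply/funext => p; rewrite scalefE fct_sumE.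
congr (_ * _); apply: eq_bigr => i _; rewrite linear_sum fct_sumE.
by apply: eq_bigr => j _; rewrite linearB/= -complete_shift.
Qed.

End Interchange.

(** * The star form dominates the complete form *)

Section StarComparison.
Context {R : realType} {n : nat}.
Implicit Types (g h : 'S_n.+1 -> R) (nu : R).

Lemma sum_star_edges (F : 'I_n.+1 -> 'I_n.+1 -> R) :
  F ord_max ord_max = 0 ->
  \sum_(i < n.+1) \sum_(j < n.+1 | (i < j)%N && star_edge i j) F i j =
  \sum_i F i ord_max.
Proof.
move=> F0; apply: eq_bigr => i _.
have [->|im] := eqVneq i ord_max.
  by rewrite big_pred0 ?F0// => j; rewrite ltnNge -ltnS ltn_ord.
rewrite (big_pred1 ord_max)// => j; rewrite /star_edge (negbTE im)/=.
have [->|] := eqVneq j ord_max; last by rewrite !andbF.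
by rewrite !andbT im ltn_neqAle -ltnS ltn_ord andbT (inj_eq val_inj) im.
Qed.

(** Telescope g p - g (a b c p) through c p and b c p, and use
    (x + y + z)^2 <= 3 (x^2 + y^2 + z^2); translation invariance of the counting
    measure identifies the three sums. *)
Lemma diff_energyM3 (a b c : 'S_n.+1) g :
  diff_energy (a * b * c) g <=
  3 * (diff_energy a g + diff_energy b g + diff_energy c g).
Proof.
have -> : diff_energy a g = \sum_p (g (b * (c * p))%g - g (a * (b * (c * p)))%g) ^+ 2.
  by rewrite (reindex_mulg c (fun p => (g (b * p)%g - g (a * (b * p))%g) ^+ 2))
             (reindex_mulg b (fun p => (g p - g (a * p)%g) ^+ 2)).
have -> : diff_energy b g = \sum_p (g (c * p)%g - g (b * (c * p))%g) ^+ 2.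
  by rewrite (reindex_mulg c (fun p => (g p - g (b * p)%g) ^+ 2)).
rewrite -!big_split mulr_sumr; apply: ler_sum => p _ /=.
rewrite -!mulgA.
set x := g p; set y := g (c * p)%g; set z := g (b * (c * p))%g; set w := g _.
(* The difference of the two sides is the sum of the squares of the pairwise
   differences of x - y, y - z and z - w. *)
have := sqr_ge0 (x - 2 * y + z); have := sqr_ge0 (y - 2 * z + w).
have := sqr_ge0 (x - y - (z - w)); nra.
Qed.

(** (i j) = (i k) (j k) (i k), when the three points are distinct. *)
Lemma diff_energy_tperm_le (i j k : 'I_n.+1) g :
  diff_energy (tperm i j) g <=
  3 * (2 * diff_energy (tperm i k) g + diff_energy (tperm j k) g).
Proof.
have [->|jk] := eqVneq j k.
  by have := diff_energy_ge0 (tperm i k) g; have := diff_energy_ge0 (tperm k k) g; lra.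
have [<-|ij] := eqVneq i j.
  rewrite {1}/diff_energy big1; last first.
    by move=> p _; rewrite tperm1 mul1g subrr expr0n.
  by have := diff_energy_ge0 (tperm i k) g; lra.
have -> : tperm i j = (tperm i k * tperm j k * tperm i k)%g.
  have := tpermJ j k (tperm i k); rewrite /conjg tpermV -mulgA tpermR (tpermD ij) 1?eq_sym//.
  by rewrite mulgA => ->; rewrite tpermC.
rewrite (le_trans (diff_energyM3 _ _ _ _))//; lra.
Qed.

Lemma inner_star nu g :
  2 * inner g (interchange_generator nu (@star_edge n) g) =
  - (nu * \sum_i diff_energy (tperm i ord_max) g).
Proof.
rewrite inner_interchange sum_star_edges// /diff_energy big1// => p _.
by rewrite tperm1 mul1g subrr expr0n.
Qed.

(** Every transposition is routed through the centre.  Over the ordered pairs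
    of positions each star edge is charged 9 (n + 1) times in total, the factor 3
    of [diff_energy_tperm_le] included, and passing from ordered pairs to
    edges halves this. *)
Lemma star_complete_dirichlet_le nu h : 0 <= nu ->
  - inner h (interchange_generator nu (@complete_edge n.+1) h) <=
  - (9 / 2 * n.+1%:R * inner h (interchange_generator nu (@star_edge n) h)).
Proof.
move=> nu0.
have cE := inner_complete nu h; have sE := inner_star nu h.
set C := \sum_i \sum_j _ in cE; set S := \sum_i _ in sE.
suff CS : nu * C <= nu * (9 * n.+1%:R * S).
  by set N := n.+1%:R in CS *; nra.
apply: ler_wpM2l => //.
rewrite (_ : 9 * _ * S = \sum_(i < n.+1) \sum_(j < n.+1)
   3 * (2 * diff_energy (tperm i ord_max) h + diff_energy (tperm j ord_max) h)).
  by do 2 apply: ler_sum => ? _; exact: diff_energy_tperm_le.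
rewrite (eq_bigr (fun i => 6 * n.+1%:R * diff_energy (tperm i ord_max) h + 3 * S)).
  rewrite big_split/= -mulr_sumr sumr_const card_ord -/S -[_ *+ _]mulr_natl.
  by ring.
move=> i _; rewrite -mulr_sumr big_split sumr_const card_ord/= -/S.
by rewrite -[_ *+ _]mulr_natl; ring.
Qed.

End StarComparison.

(** * The spectral gap of the complete graph *)

Section CompleteGap.
Context {R : realType} {n : nat}.
Implicit Types (g h : 'S_n -> R) (nu a : R) (B : {set 'I_n}).

(** Invariance under the symmetric group of B, expressed on its generators. *)
Definition tperm_invariant B h :=
  forall i j, i \in B -> j \in B -> forall p, h (tperm i j * p)%g = h p.

(** The transpositions (i k), for i in B or i = k, represent the cosets of
    the symmetric group of B in that of k |: B.  Summing a function invariant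
    under the smaller group over them symmetrizes it under the larger one;
    precomposing with (u v) only permutes the cosets. *)
Lemma tperm_invariantU1 B k h : tperm_invariant B h -> k \notin B ->
  tperm_invariant (k |: B) (fun p => \sum_(i in k |: B) h (tperm i k * p)%g).
Proof.
move=> hB kB u v uB vB p.
have step_k w i : w \in B -> i \in k |: B ->
    h (tperm i k * (tperm k w * p))%g = h (tperm (tperm k w i) k * p)%g.
  move=> wB; case: tpermP => [->|->|/eqP ik /eqP iw] iB.
  - by rewrite tperm1 mul1g tpermC.
  - by rewrite tperm1 mul1g mulgA tpermC tperm2 mul1g.
  - rewrite mulgA (conjgCV (tperm i k)) tpermV tpermJ tpermR (tpermD iw); last first.
      by apply: contraNneq kB => ->.
    by rewrite -mulgA (hB i w)//; move: iB; rewrite !inE (negbTE ik).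
have step i : i \in k |: B ->
    h (tperm i k * (tperm u v * p))%g = h (tperm (tperm u v i) k * p)%g.
  move=> iB; move: uB vB; rewrite !inE.
  case: (eqVneq u k) => [-> _|uk /= uB]; case: (eqVneq v k) => [-> _|vk /= vB].
  - by rewrite tperm1 mul1g perm1.
  - exact: step_k.
  - by rewrite (tpermC u) step_k.
  - rewrite mulgA (conjgC (tperm i k)) tpermJ -mulgA (hB u v)//.
    by rewrite (@tpermD _ u v k) 1?eq_sym// eq_sym.
rewrite (eq_bigr _ step) [RHS](reindex_inj (@perm_inj _ (tperm u v)))/=.
apply: eq_bigl => i.
by case: tpermP => [->|->|//]; rewrite uB vB.
Qed.

(** The bound is attained, by functions of the value at one position
    ([complete_value]).  The proof finds in the eigenspace a vector with the
    largest possible symmetry B; on such a vector the edges meeting B in one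
    point act by a scalar, which is what bounds the eigenvalue from below. *)
Lemma complete_eigenvalue_ge nu a : 0 < nu -> 0 < a ->
  eigenvalue_opp_generator (interchange_generator nu (@complete_edge n)) a ->
  nu * n%:R <= a.
Proof.
move=> nu0 a0 [g [x gx0] gE].
pose eig h := forall p, - interchange_generator nu (@complete_edge n) h p = a * h p.
pose P B := `[< exists h, [/\ exists p, h p != 0, eig h & tperm_invariant B h] >].
have P0 : P finset.set0.
  by apply/asboolP; exists g; split => //; [exists x|move=> i j; rewrite inE].
have [B /maxsetP[/asboolP[h [h0 hE hB]] Bmax] _] := maxset_exists P0.
have BT : B != [set: 'I_n]%SET.
  apply/eqP => BT; case: h0 => p; apply/negP; rewrite negbK.
  have : a * h p = 0.
    rewrite -hE; apply/eqP; rewrite oppr_eq0 -(mulrI_eq0 _ (@mulfI _ 2 _)) ?pnatr_eq0//.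
    rewrite complete_generatorE big1 ?mulr0// => i _; rewrite big1// => j _.
    by rewrite hB ?subrr// BT inE.
  by move/eqP; rewrite mulf_eq0 (gt_eqF a0).
have sum_out k : k \notin B -> forall p, \sum_(i in B) h (tperm i k * p)%g = - h p.
  move=> kB p; pose f p := \sum_(i in k |: B) h (tperm i k * p)%g.
  suff : f p = 0.
    rewrite /f big_setU1//= tperm1 mul1g => /eqP; rewrite addrC addr_eq0.
    by move/eqP.
  apply/eqP; apply: contraT => fp; have : k |: B = B.
    apply: Bmax; last exact: finset.subsetUr.
    apply/asboolP; exists f; split; [by exists p| |exact: tperm_invariantU1].
    move=> q; have -> : f = \sum_(i in k |: B) (fun p => h (tperm i k * p)%g).
      by apply/funext => u; rewrite fct_sumE.
    rewrite linear_sum !fct_sumE -sumrN mulr_sumr; apply: eq_bigr => i _.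
    by rewrite -hE; congr (- _); exact: complete_shift.
  by move/setP/(_ k); rewrite setU11 (negbTE kB).
have hh0 : 0 < inner h h.
  case: h0 => p hp; rewrite /inner (bigD1 p)//= ltr_pwDl//.
    by rewrite -expr2 exprn_even_gt0.
  by apply: sumr_ge0 => q _; rewrite -expr2 sqr_ge0.
pose D i j := diff_energy (tperm i j) h.
have D0 i j : 0 <= D i j by exact: diff_energy_ge0.
(* By sum_out, one position k outside B and the positions of B together
   contribute the scalar #|B| + 1. *)
have sumD k : k \notin B -> \sum_(i in B) D i k = 2 * (#|B|%:R + 1) * inner h h.
  move=> kB.
  have DE i : D i k = 2 * inner h h - 2 * \sum_p h p * h (tperm i k * p)%g.
    have sq : \sum_p h (tperm i k * p)%g ^+ 2 = inner h h.
      by rewrite (reindex_mulg _ (fun p => h p ^+ 2)).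
    rewrite mulrDl mul1r -{2}sq /D /diff_energy mulr_sumr -big_split -sumrB.
    by apply: eq_bigr => p _ /=; ring.
  under eq_bigr => i _ do rewrite DE.
  rewrite sumrB sumr_const -mulr_sumr exchange_big/=.
  under [X in _ - 2 * X]eq_bigr => p _ do rewrite -mulr_sumr sum_out// mulrN.
  by rewrite sumrN -/(inner h h) -mulr_natr; ring.
have sum_ge : 2 * \sum_(k | k \notin B) \sum_(i in B) D i k <= \sum_i \sum_j D i j.
  rewrite [leRHS](bigID (mem B))/= mulr_natl mulr2n lerD//.
    rewrite exchange_big; apply: ler_sum => i iB.
    by rewrite [leRHS](bigID (mem B))/= lerDr sumr_ge0.
  apply: ler_sum => k kB; rewrite [leRHS](bigID (mem B))/=.
  rewrite (eq_bigr (D k)) ?lerDl ?sumr_ge0// => i _.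
  by rewrite /D tpermC.
have := inner_complete nu h; rewrite -/D.
have -> : inner h (interchange_generator nu (@complete_edge n) h) = - (a * inner h h).
  rewrite /inner mulr_sumr -sumrN; apply: eq_bigr => p _.
  rewrite [RHS](_ : _ = h p * - (a * h p)); last by ring.
  by congr (_ * _); rewrite -hE opprK.
move=> eqD.
(* m <= (m - b) (b + 1) for 0 <= b < m. *)
have card : (n <= (n - #|B|) * #|B|.+1)%N.
  have : (#|B| < n)%N.
    by rewrite -[ltnRHS]card_ord -cardsT proper_card// properT.
  by move: #|B| => b; nia.
have {}card : n%:R <= #|~: B|%:R * (#|B|%:R + 1) :> R.
  by rewrite natr1 -natrM ler_nat cardsCs finset.setCK card_ord.
have cE : \sum_(k | k \notin B) \sum_(i in B) D i k =
    #|~: B|%:R * (2 * (#|B|%:R + 1) * inner h h).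
  rewrite (eq_bigr _ sumD) sumr_const [RHS]mulr_natl; congr (_ *+ _).
  by apply: eq_card => k; rewrite !inE.
move: sum_ge; rewrite cE -(ler_pM2l nu0) => sum_ge.
rewrite -(ler_pM2r hh0).
have : nu * (n%:R * inner h h) <= nu * (#|~: B|%:R * (#|B|%:R + 1) * inner h h).
  by rewrite ler_pM2l// ler_pM2r.
move: eqD sum_ge; rewrite -/D; set S := nu * \sum_i _; move: S => S eqD sum_ge; lra.
Qed.

End CompleteGap.

(** * Relaxation times *)

Section RelaxationTime.
Context {R : realType} {T : finType}.
Implicit Types (Q : {linear (T -> R) -> (T -> R)}).

Lemma poly_roots_finite (p : {poly R}) : p != 0 ->
  exists s : seq R, forall a, root p a -> a \in s.
Proof.
have [m] := ubnP (size p); elim: m p => // m IH p pm p0.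
have [[a pa]|noroot] := pselect (exists a, root p a); last first.
  by exists [::] => a pa; case: noroot; exists a.
move: (pa) pm p0 => /factor_theorem[q ->] qm q0.
have q00 : q != 0 by apply: contraNneq q0 => ->; rewrite mul0r.
have [|s sP] := IH q _ q00.
  by move: qm; rewrite size_Mmonic ?monicXsubC// size_XsubC addn2.
exists (a :: s) => b; rewrite rootM root_XsubC inE => /orP[/sP ->|->//].
by rewrite orbT.
Qed.

(** Eigenvalues of -Q are roots of the characteristic polynomial of its
    matrix in the basis of indicators. *)
Lemma eigenvalues_finite Q :
  exists s : seq R, forall a, eigenvalue_opp_generator Q a -> a \in s.
Proof.
(* Row vectors act on the left, so the rows of A are the images of indicators. *)
pose A : 'M[R]_#|T| :=
  \matrix_(i, j) - Q (fun z => (z == enum_val i)%:R) (enum_val j).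
have [s sP] := @poly_roots_finite (char_poly A) (monic_neq0 (char_poly_monic A)).
exists s => a [g [x gx0] gE]; apply: sP; rewrite -eigenvalue_root_char.
apply/eigenvalueP; exists (\row_i g (enum_val i)); last first.
  apply/negP => /eqP/rowP/(_ (enum_rank x)); rewrite !mxE enum_rankK.
  exact/eqP.
apply/rowP => j; rewrite !mxE -gE linear_kernel -sumrN.
rewrite [RHS](reindex (@enum_val T T)); last exact: onW_bij (@enum_val_bij T).
by apply: eq_bigr => i _; rewrite !mxE mulrN.
Qed.

(** Descent: as long as a smaller positive eigenvalue exists, pass to it and
    discard it from the finite list of candidates. *)
Lemma smallest_pos_eigenvalue_exists Q l :
  0 < l -> eigenvalue_opp_generator Q l ->
  exists a, is_smallest_pos_eigenvalue Q a.
Proof.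
move=> l0 Ql; have [s sP] := eigenvalues_finite Q.
have {sP} : forall b, 0 < b -> eigenvalue_opp_generator Q b -> b < l -> b \in s.
  by move=> b _ Qb _; exact: sP.
have [m] := ubnP (size s); elim: m => // m IH in s l l0 Ql *; move=> sm sP.
have [[b [b0 Qb bl]]|nob] := pselect (exists b,
    [/\ 0 < b, eigenvalue_opp_generator Q b & b < l]); last first.
  exists l; split => // b b0 Qb; rewrite leNgt; apply/negP => bl.
  by apply: nob; exists b.
apply: (IH [seq c <- s | c != b] b) => //.
  rewrite size_filter -ltnS; apply: leq_trans sm; rewrite ltnS.
  rewrite -(count_predC (fun c => c != b) s) -[ltnLHS]addn0 ltn_add2l -has_count.
  by apply/hasP; exists b; [exact: sP|rewrite /= negbK].
move=> c c0 Qc cb; rewrite mem_filter/= lt_eqF//=.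
by apply: sP => //; exact: lt_trans bl.
Qed.

Lemma relaxation_timeP Q l : 0 < l -> eigenvalue_opp_generator Q l ->
  exists2 a, is_smallest_pos_eigenvalue Q a & relaxation_time Q = a^-1.
Proof.
move=> l0 Ql; have [a aP] := smallest_pos_eigenvalue_exists l0 Ql.
exists (get [set a | is_smallest_pos_eigenvalue Q a]) => //.
exact: (getI (P := [set a | is_smallest_pos_eigenvalue Q a]) aP).
Qed.

Lemma relaxation_time_ge Q l : 0 < l -> eigenvalue_opp_generator Q l ->
  l^-1 <= relaxation_time Q.
Proof.
move=> l0 Ql; have [a [a0 Qa amin] ->] := relaxation_timeP l0 Ql.
by rewrite lef_pV2 ?posrE// amin.
Qed.

Lemma relaxation_time_eq Q l : is_smallest_pos_eigenvalue Q l ->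
  relaxation_time Q = l^-1.
Proof.
move=> [l0 Ql lmin]; have [a [a0 Qa amin] ->] := relaxation_timeP l0 Ql.
by congr (_^-1); apply/le_anti; rewrite amin// lmin.
Qed.

End RelaxationTime.

(** * Functions of the value at a position *)

Section Positions.
Context {R : realType} {n : nat}.
Implicit Types (nu : R) (F : 'I_n.+1 -> R).

Definition value_at F (i : 'I_n.+1) (s : 'S_n.+1) : R := F (s i).

Lemma star_generatorE nu (g : 'S_n.+1 -> R) p :
  interchange_generator nu (@star_edge n) g p =
  nu * \sum_i (g (tperm i ord_max * p)%g - g p).
Proof.
by rewrite /interchange_generator sum_star_edges// tperm1 mul1g subrr.
Qed.

(** Swapping k with a uniform position resamples the value at k uniformly. *)
Lemma sum_value_swap F (k : 'I_n.+1) (p : 'S_n.+1) :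
  \sum_i (value_at F k (tperm i k * p)%g - value_at F k p) =
  (\sum_v F v) - n.+1%:R * value_at F k p.
Proof.
rewrite sumrB sumr_const card_ord mulr_natl; congr (_ - _).
rewrite [RHS](reindex_inj (@perm_inj _ p))/=; apply: eq_bigr => i _.
by rewrite /value_at permM tpermR.
Qed.

Lemma star_value_max nu F p :
  interchange_generator nu (@star_edge n) (value_at F ord_max) p =
  nu * ((\sum_v F v) - n.+1%:R * value_at F ord_max p).
Proof. by rewrite star_generatorE sum_value_swap. Qed.

Lemma complete_value nu F k p :
  interchange_generator nu (@complete_edge n.+1) (value_at F k) p =
  nu * ((\sum_v F v) - n.+1%:R * value_at F k p).
Proof.
apply: (@mulfI _ 2); first by rewrite pnatr_eq0.
rewrite complete_generatorE mulrCA; congr (_ * _).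
rewrite -(sum_value_swap F k p) mulr_natl mulr2n.
rewrite (bigD1 k)//= addrC; congr (_ + _).
  rewrite [RHS](bigD1 k)//= tperm1 mul1g subrr add0r; apply: eq_bigr => i ik.
  rewrite (bigD1 k)//= big1 ?addr0// => j jk.
  by rewrite /value_at permM tpermD ?subrr.
by apply: eq_bigr => i _; rewrite tpermC.
Qed.

(** The value at a position is uniformly distributed: all positions have the
    same mean, and their sum over positions is constant. *)
Lemma mean_value_at F k : mean (value_at F k) = n.+1%:R^-1 * \sum_v F v.
Proof.
have swap j : \sum_s value_at F j s = \sum_s value_at F k s.
  rewrite -(reindex_mulg (tperm j k)); apply: eq_bigr => s _.
  by rewrite /value_at permM tpermL.
have eq_sums : n.+1%:R * \sum_s value_at F k s = #|'S_n.+1|%:R * \sum_v F v.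
  transitivity (\sum_(j < n.+1) \sum_s value_at F j s).
    by rewrite (eq_bigr _ (fun j _ => swap j)) sumr_const card_ord mulr_natl.
  rewrite exchange_big/= (eq_bigr (fun=> \sum_v F v)).
    by rewrite sumr_const mulr_natl.
  by move=> s _; rewrite [RHS](reindex_inj (@perm_inj _ s)).
have N0 : #|'S_n.+1|%:R != 0 :> R.
  by rewrite pnatr_eq0 -lt0n; apply/card_gt0P; exists 1%g.
rewrite /mean; apply: (mulfI N0); rewrite mulrA divff// mul1r.
apply: (@mulfI _ n.+1%:R); first by rewrite pnatr_eq0.
by rewrite eq_sums mulrCA; congr (_ * _); rewrite mulrA divff ?mul1r// pnatr_eq0.
Qed.

(** The eigenvalue 1 of the Laplacian of the star, whose eigenvectors vanish
    at the centre and sum to zero, is lifted to permutations through the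
    position-value indicator functions; two leaves are needed. *)
Lemma star_eigenvalue nu : (1 < n)%N ->
  eigenvalue_opp_generator (interchange_generator nu (@star_edge n)) nu.
Proof.
move=> n1; pose F (v : 'I_n.+1) : R := (v == ord0)%:R.
have n0 : (0 < n)%N by exact: leq_trans n1.
pose k1 : 'I_n.+1 := inord 1.
have k1E : val k1 = 1%N by rewrite /= inordK.
exists (value_at F ord0 - value_at F k1).
  exists 1%g; rewrite /value_at.
  rewrite (_ : (_ - _) _ = F ((1%g : 'S_n.+1) ord0) - F ((1%g : 'S_n.+1) k1))//.
  by rewrite !perm1 /F eqxx -val_eqE k1E subr0 oner_neq0.
move=> p; rewrite star_generatorE -mulrN; congr (_ * _).
pose d k i := value_at F k (tperm i ord_max * p)%g - value_at F k p.
have sum_d k : k != ord_max -> \sum_i d k i = F (p ord_max) - F (p k).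
  move=> km; rewrite (bigD1 k)//= big1 ?addr0 => [|i ik].
    by rewrite /d /value_at permM tpermL.
  by rewrite /d /value_at permM tpermD ?subrr// eq_sym.
rewrite (eq_bigr (fun i => d ord0 i - d k1 i)); last first.
  move=> i _; rewrite /d.
  rewrite -[(_ - _) _]/(value_at F ord0 _ - value_at F k1 _).
  by rewrite -[(value_at F ord0 - _) p]/(value_at F ord0 p - value_at F k1 p); ring.
rewrite sumrB !sum_d.
- by rewrite -[(value_at F ord0 - _) p]/(F (p ord0) - F (p k1)); ring.
- by rewrite -val_eqE k1E eqn_leq [X in _ && X]leqNgt n1 andbF.
- by rewrite -val_eqE /= eq_sym -lt0n.
Qed.

(** Any function F of the value with zero sum works; this one is the centred
    indicator of a point, which is nonzero as soon as there are two points. *)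
Lemma value_eigenvalue nu (e : rel 'I_n.+1) : (0 < n)%N ->
  (forall F p, interchange_generator nu e (value_at F ord_max) p =
    nu * ((\sum_v F v) - n.+1%:R * value_at F ord_max p)) ->
  eigenvalue_opp_generator (interchange_generator nu e) (nu * n.+1%:R).
Proof.
move=> n0 eE; pose F (v : 'I_n.+1) : R := (v == ord0)%:R - n.+1%:R^-1.
have F0 : \sum_v F v = 0.
  rewrite sumrB sumr_const card_ord -[_ *+ _]mulr_natl divff ?pnatr_eq0//.
  by rewrite (bigD1 ord0)//= big1 ?addr0 ?subrr// => v /negbTE ->.
exists (value_at F ord_max); last first.
  by move=> p; rewrite eE F0 sub0r mulrN opprK mulrA.
exists 1%g; rewrite /value_at perm1 /F -val_eqE/= eqn0Ngt n0/= sub0r oppr_eq0.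
by rewrite invr_eq0 pnatr_eq0.
Qed.

Lemma relaxation_time_complete nu : 0 < nu -> (0 < n)%N ->
  relaxation_time (interchange_generator nu (@complete_edge n.+1)) =
  (nu * n.+1%:R)^-1.
Proof.
move=> nu0 n0; apply: relaxation_time_eq; split.
- by rewrite mulr_gt0.
- by apply: value_eigenvalue => // F p; exact: complete_value.
- by move=> b b0; exact: complete_eigenvalue_ge.
Qed.

(** With at least three points the eigenvalue nu of [star_eigenvalue] is
    available.  With two points the star is a single edge and its only positive
    eigenvalue is 2 nu, which is where the factor 2 comes from. *)
Lemma relaxation_time_star_ge nu : 0 < nu -> (0 < n)%N ->
  (2 * nu)^-1 <= relaxation_time (interchange_generator nu (@star_edge n)).
Proof.
move=> nu0 n0; have [n1|n1] := ltnP 1 n.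
  apply: le_trans (relaxation_time_ge nu0 (star_eigenvalue nu n1)).
  by rewrite lef_pV2 ?posrE ?mulr_gt0//; lra.
have -> : 2 * nu = nu * n.+1%:R by rewrite mulrC; congr (_ * _%:R); lia.
apply: relaxation_time_ge; first by rewrite mulr_gt0.
by apply: value_eigenvalue => // F p; exact: star_value_max.
Qed.

End Positions.

(** * Passing noise sensitivity and stability between the graphs *)

Section NoiseComparison.
Context {R : realType}.
Variable nu : R.
Hypothesis nu0 : 0 < nu.

Notation QK n := (interchange_generator nu (@complete_edge n.+1)).
Notation QS n := (interchange_generator nu (@star_edge n)).
Notation unif n := (@uniform_dist R 'S_n.+1).

Lemma card_Sn_gt0 n : (0 < #|'S_n|)%N.
Proof. by apply/card_gt0P; exists 1%g. Qed.

(** The factor 9 is the 9/2 of [star_complete_dirichlet_le] times the 2 of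
    [relaxation_time_star_ge]; the number of points cancels against the
    relaxation time of the complete graph. *)
Lemma correlation_star_le n alpha (f : 'S_n.+1 -> bool) : (0 < n)%N -> 0 < alpha ->
  correlation (QS n) (9 * alpha * relaxation_time (QS n)) f <=
  correlation (QK n) (alpha * relaxation_time (QK n)) f.
Proof.
move=> n0 alpha0; rewrite ler_wpM2l//; apply: inner_heat_le.
- exact: interchange_symmetric.
- exact: interchange_symmetric.
- by move=> h; exact: complete_commute.
move=> h; have := star_complete_dirichlet_le h (ltW nu0).
have : inner h (QS n h) <= 0.
  rewrite -(@pmulr_rle0 _ 2)// inner_star oppr_le0 mulr_ge0 ?(ltW nu0)//.
  by apply: sumr_ge0 => i _; exact: diff_energy_ge0.
rewrite relaxation_time_complete//.
have := relaxation_time_star_ge nu0 n0.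
set s := inner h _; set k := inner h _; set tS := relaxation_time _.
move=> tS_ge s0 ks.
have m0 : 0 < n.+1%:R :> R by [].
have step1 : 9 * alpha * tS * s <= 9 * alpha * (2 * nu)^-1 * s.
  by rewrite ler_wnM2r// ler_pM2l// mulr_gt0.
apply: le_trans step1 _.
rewrite [leLHS](_ : _ = alpha * (nu * n.+1%:R)^-1 * (9 / 2 * n.+1%:R * s)).
  by rewrite ler_pM2l ?mulr_gt0 ?invr_gt0 ?mulr_gt0// -lerN2.
by field; rewrite ?lt0r_neq0// pnatr_eq0.
Qed.

Lemma covE n (e : rel 'I_n.+1) t (f : 'S_n.+1 -> bool) :
  chain_cov (unif n) (interchange_generator nu e) t f =
  correlation (interchange_generator nu e) t f - mean (indic_fun f) ^+ 2.
Proof.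
apply: chain_covE; [exact: interchange_symmetric|].
exact: interchange_cst1.
Qed.

Lemma cov_ge0 n (e : rel 'I_n.+1) t (f : 'S_n.+1 -> bool) :
  0 <= chain_cov (unif n) (interchange_generator nu e) t f.
Proof.
rewrite covE subr_ge0; apply: mean_sqr_le_correlation; first exact: card_Sn_gt0.
  exact: interchange_symmetric.
exact: interchange_cst1.
Qed.

Lemma disagreeE n (e : rel 'I_n.+1) t (f : 'S_n.+1 -> bool) :
  chain_disagree (unif n) (interchange_generator nu e) t f =
  2 * (mean (indic_fun f) - correlation (interchange_generator nu e) t f).
Proof.
apply: chain_disagreeE; [exact: interchange_symmetric|].
exact: interchange_cst1.
Qed.

(** The one-point case, where the relaxation time is meaningless but enters the
    supremum over n. *)
Lemma disagree_S1 (e : rel 'I_1) t (f : 'S_1 -> bool) :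
  chain_disagree (unif 0) (interchange_generator nu e) t f = 0.
Proof.
rewrite /chain_disagree /expect2 big1// => x _; rewrite big1// => y _.
have -> : x = y by apply/permP => i; rewrite !ord1.
by rewrite eqxx mulr0.
Qed.

Lemma noise_sensitive_complete_star (f : forall n, 'S_n.+1 -> bool) :
  noise_sensitive_complete nu f -> noise_sensitive_star nu f.
Proof.
move=> sK alpha alpha0.
have a9 : 0 < alpha / 9 by rewrite divr_gt0.
apply: squeeze_cvgr (cvg_cst 0) (sK _ a9); near=> n.
rewrite cov_ge0 !covE lerD2r.
have n0 : (0 < n)%N by near: n; exists 1%N.
by have := correlation_star_le (f n) n0 a9; rewrite (_ : 9 * (alpha / 9) = alpha)//; field.
Unshelve. all: by end_near. Qed.

Definition sup_disagree (e : forall n, rel 'I_n.+1)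
    (f : forall n, 'S_n.+1 -> bool) (alpha : R) : \bar R :=
  ereal_sup (range (fun n : nat =>
    (chain_disagree (unif n) (interchange_generator nu (e n))
      (alpha * relaxation_time (interchange_generator nu (e n))) (@f n))%:E)).

Lemma sup_disagree_ge (e : forall n, rel 'I_n.+1) f alpha n :
  ((chain_disagree (unif n) (interchange_generator nu (e n))
      (alpha * relaxation_time (interchange_generator nu (e n))) (@f n))%:E
  <= sup_disagree e f alpha)%E.
Proof. by apply: ereal_sup_ubound; exists n. Qed.

Lemma sup_disagree_ge0 (e : forall n, rel 'I_n.+1) f alpha :
  (0 <= sup_disagree e f alpha)%E.
Proof.
by apply: le_trans (sup_disagree_ge e f alpha 0%N); rewrite disagree_S1.
Qed.

Lemma noise_stable_star_complete (f : forall n, 'S_n.+1 -> bool) :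
  noise_stable_star nu f -> noise_stable_complete nu f.
Proof.
move=> sS.
have sS9 : sup_disagree star_edge f (9 * alpha) @[alpha --> (0 : R)^'+] --> (0%E : \bar R).
  apply: (cvg_comp _ _ _ sS) => A [r /= r0 rA].
  exists (r / 9) => /=; first by rewrite divr_gt0.
  move=> x /=; rewrite sub0r normrN => xr x0; apply: rA; rewrite /= ?mulr_gt0//.
  by rewrite sub0r normrN normrM ger0_norm// mulrC -ltr_pdivlMr.
apply: (squeeze_cvge _ (cvg_cst 0%E) sS9); near=> alpha.
rewrite [X in (X <= _ <= _)%E]/= (sup_disagree_ge0 (fun n => @complete_edge n.+1) f)/=.
apply: ge_ereal_sup => _ [n _ <-].
apply: le_trans (sup_disagree_ge _ _ _ n).
case: n => [|n]; first by rewrite !disagree_S1.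
rewrite lee_fin !disagreeE ler_pM2l// lerD2l lerN2.
by apply: correlation_star_le => //; near: alpha; exact: nbhs_right_gt.
Unshelve. all: by end_near. Qed.

End NoiseComparison.

(** * Dictators *)

Section Dictator.
Context {R : realType}.
Variables (nu eps : R).
Hypotheses (nu0 : 0 < nu) (eps0 : 0 < eps) (eps1 : eps < 1).

Notation QK n := (interchange_generator nu (@complete_edge n.+1)).
Notation QS n := (interchange_generator nu (@star_edge n)).
Notation unif n := (@uniform_dist R 'S_n.+1).

Definition dictator_mean n : R := mean (indic_fun (@dictator R eps n) : 'S_n.+1 -> R).

Let threshold n (v : 'I_n.+1) : R := (v.+1%:R <= eps * n.+1%:R)%R%:R.

Lemma dictator_value n : indic_fun (@dictator R eps n) = value_at (@threshold n) ord_max.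
Proof. by []. Qed.

(** The value at the centre is uniform, and the number of admissible values is
    the integer part of eps (n + 1). *)
Lemma dictator_meanE n :
  dictator_mean n = (Num.truncn (eps * n.+1%:R))%:R / n.+1%:R.
Proof.
rewrite /dictator_mean dictator_value mean_value_at mulrC; congr (_ / _).
set t := Num.truncn _.
have e0 : 0 <= eps * n.+1%:R by rewrite mulr_ge0// ltW.
have tn : (t <= n.+1)%N.
  rewrite -(ler_nat R); apply: le_trans (_ : eps * n.+1%:R <= _).
    by rewrite -truncn_ge_nat.
  by rewrite ler_piMl// ltW.
rewrite (eq_bigr (fun v : 'I_n.+1 => if (v < t)%N then 1 else 0)).
  by rewrite -big_mkcond -(big_ord_widen _ (fun=> 1) tn) sumr_const card_ord.
by move=> v _; rewrite /threshold -truncn_ge_nat// -/t; case: ifP.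
Qed.

Lemma dictator_mean_bounds n : eps - n.+1%:R^-1 <= dictator_mean n <= eps.
Proof.
rewrite dictator_meanE.
have e0 : 0 <= eps * n.+1%:R by rewrite mulr_ge0// ltW.
have /andP[tle ltt] := truncn_itv e0.
rewrite ler_pdivrMr// tle andbT ler_pdivlMr// mulrBl mulVf ?pnatr_eq0//.
by rewrite lerBlDr natr1 ltW.
Qed.

Lemma dictator_mean_cvg : dictator_mean n @[n --> \oo] --> eps.
Proof.
apply: (squeeze_cvgr (f := fun n => eps - harmonic n) (h := cst eps)).
- by near=> n; exact: dictator_mean_bounds.
- rewrite -[X in _ --> X]subr0; apply: cvgB; [exact: cvg_cst|exact: cvg_harmonic].
- exact: cvg_cst.
Unshelve. all: by end_near. Qed.

Definition dictator_var n := dictator_mean n - dictator_mean n ^+ 2.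

Lemma dictator_var_cvg : dictator_var n @[n --> \oo] --> eps - eps ^+ 2.
Proof.
apply: cvgB; first exact: dictator_mean_cvg.
by rewrite expr2; apply: cvgM; exact: dictator_mean_cvg.
Qed.

Lemma dictator_var_bounds n : 0 <= dictator_var n <= 1.
Proof.
have /andP[_ le1] := dictator_mean_bounds n.
have ge0 : 0 <= dictator_mean n by rewrite dictator_meanE divr_ge0.
have le1' : dictator_mean n <= 1 by exact: le_trans le1 (ltW eps1).
rewrite /dictator_var; move: ge0 le1'; set p := dictator_mean n => p0 p1.
by apply/andP; split; nra.
Qed.

Lemma eps_var_gt0 : 0 < eps - eps ^+ 2.
Proof. by rewrite expr2 -{1}(mulr1 eps) -mulrBr mulr_gt0// subr_gt0. Qed.

(** The hypothesis on the generator is the eigenfunction property shared by the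
    star and the complete graph ([star_value_max], [complete_value]). *)
Lemma dictator_correlation n (e : rel 'I_n.+1) t :
  (forall F p, interchange_generator nu e (value_at F ord_max) p =
    nu * ((\sum_v F v) - n.+1%:R * value_at F ord_max p)) ->
  correlation (interchange_generator nu e) t (@dictator R eps n) =
  dictator_mean n ^+ 2 + expR (- (nu * n.+1%:R) * t) * dictator_var n.
Proof.
move=> eE; apply: correlation_eigen.
- exact: card_Sn_gt0.
- exact: interchange_symmetric.
- exact: interchange_cst1.
apply/funext => p; apply: etrans (eE (@threshold n) p) _; rewrite scalefE.
rewrite -[centered _ p]/(value_at (@threshold n) ord_max p
   - mean (value_at (@threshold n) ord_max) * 1).
rewrite mean_value_at; set m := n.+1%:R.
have m0 : m != 0 by rewrite /m pnatr_eq0.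
by field.
Qed.

Lemma dictator_cov n (e : rel 'I_n.+1) t :
  (forall F p, interchange_generator nu e (value_at F ord_max) p =
    nu * ((\sum_v F v) - n.+1%:R * value_at F ord_max p)) ->
  chain_cov (unif n) (interchange_generator nu e) t (@dictator R eps n) =
  expR (- (nu * n.+1%:R) * t) * dictator_var n.
Proof. by move=> eE; rewrite covE dictator_correlation// addrC addKr. Qed.

Lemma dictator_disagree n (e : rel 'I_n.+1) t :
  (forall F p, interchange_generator nu e (value_at F ord_max) p =
    nu * ((\sum_v F v) - n.+1%:R * value_at F ord_max p)) ->
  chain_disagree (unif n) (interchange_generator nu e) t (@dictator R eps n) =
  2 * (1 - expR (- (nu * n.+1%:R) * t)) * dictator_var n.
Proof.
move=> eE; rewrite disagreeE dictator_correlation// -/(dictator_mean n).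
by rewrite /dictator_var; ring.
Qed.

Lemma complete_decay n alpha : (0 < n)%N ->
  - (nu * n.+1%:R) * (alpha * relaxation_time (QK n)) = - alpha.
Proof.
move=> n0; rewrite relaxation_time_complete//; field.
by rewrite ?lt0r_neq0// ?pnatr_eq0.
Qed.

Lemma dictator_not_sensitive_complete :
  ~ noise_sensitive_complete nu (dictator eps).
Proof.
move=> /(_ 1 ltr01) cov0.
have : expR (- 1) * dictator_var n @[n --> \oo] --> (0 : R).
  apply: cvg_trans cov0; apply: near_eq_cvg; near=> n.
  rewrite (dictator_cov _ (fun F => complete_value nu F ord_max)) complete_decay//.
  by near: n; exists 1%N.
have : expR (- 1) * dictator_var n @[n --> \oo] --> expR (- 1) * (eps - eps ^+ 2).
  by apply: cvgM; [exact: cvg_cst|exact: dictator_var_cvg].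
move=> /cvg_unique c1 /c1 => /(_ (@Rhausdorff R)) /eqP.
by rewrite mulf_eq0 !gt_eqF ?expR_gt0 ?eps_var_gt0.
Unshelve. all: by end_near. Qed.

Lemma dictator_sensitive_star : noise_sensitive_star nu (dictator eps).
Proof.
move=> alpha alpha0.
pose r := expR (- (alpha / 2)).
have r1 : `|r| < 1.
  by rewrite ger0_norm ?expR_ge0// -expR0 ltr_expR oppr_lt0 divr_gt0.
apply: (squeeze_cvgr (f := cst 0) (h := fun n => r ^+ n)).
- near=> n; rewrite cov_ge0/= dictator_cov; last by move=> F p; exact: star_value_max.
  have /andP[v0 v1] := dictator_var_bounds n.
  apply: le_trans (_ : expR (- (nu * n.+1%:R)
    * (alpha * relaxation_time (QS n))) <= _); first by rewrite ler_piMr ?expR_ge0.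
  rewrite -expRM_natl ler_expR mulNr mulrN lerN2.
  have n0 : (0 < n)%N by near: n; exists 1%N.
  have := relaxation_time_star_ge nu0 n0; set tS := relaxation_time _ => tSge.
  apply: le_trans (_ : nu * n.+1%:R * (alpha * (2 * nu)^-1) <= _).
    rewrite [leRHS](_ : _ = n.+1%:R * (alpha / 2)); last first.
      by field; rewrite lt0r_neq0.
    by rewrite ler_pM2r ?divr_gt0// ler_nat.
  by rewrite ler_pM2l ?mulr_gt0// ler_pM2l.
- exact: cvg_cst.
- exact: cvg_expr.
Unshelve. all: by end_near. Qed.

Lemma dictator_stable_complete : noise_stable_complete nu (dictator eps).
Proof.
have lim0 : (2 * alpha)%:E @[alpha --> (0 : R)^'+] --> (0%E : \bar R).
  apply: cvg_EFin; first by near=> x.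
  apply: cvg_at_right_filter; rewrite -[X in _ --> X](mulr0 2).
  by apply: cvgM; [exact: cvg_cst|exact: cvg_id].
apply: (squeeze_cvge _ (cvg_cst 0%E) lim0); near=> alpha.
rewrite [X in (X <= _ <= _)%E]/= (sup_disagree_ge0 nu (fun n => @complete_edge n.+1))/=.
have alpha0 : 0 < alpha by near: alpha; exact: nbhs_right_gt.
apply: ge_ereal_sup => _ [[|n] _ <-].
  by rewrite disagree_S1 lee_fin mulr_ge0// ltW.
rewrite lee_fin dictator_disagree; last by move=> F p; exact: complete_value.
rewrite complete_decay//.
have /andP[v0 v1] := dictator_var_bounds n.+1.
have := expR_ge1Dx (- alpha); have := expR_gt0 (- alpha).
have : expR (- alpha) <= 1 by rewrite -expR0 ler_expR oppr_le0 ltW.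
set x := expR _; set w := dictator_var _ in v0 v1 *; nra.
Unshelve. all: by end_near. Qed.

(** Sensitivity makes the disagreement probability tend to twice the limiting
    variance for every alpha > 0, so the supremum over n cannot become
    small. *)
Lemma dictator_not_stable_star : ~ noise_stable_star nu (dictator eps).
Proof.
move=> stab; pose c := eps - eps ^+ 2; have c0 : 0 < c by exact: eps_var_gt0.
have [alpha [alpha0 small]] : exists alpha : R, 0 < alpha /\
    (sup_disagree nu star_edge (dictator eps) alpha <= c%:E)%E.
  have nearA : nbhs (0%E : \bar R) [set y | (y <= c%:E)%E].
    have : \forall r \near (0 : R), r <= c by exact: lt_le_nbhsl.
    by apply: filterS => r; rewrite /= lee_fin.
  have [alpha [? ?]] := filter_ex (filterI (nbhs_right_gt 0) (stab _ nearA)).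
  by exists alpha.
have dis_le n : chain_disagree (unif n) (QS n) (alpha * relaxation_time (QS n))
    (@dictator R eps n) <= c.
  by rewrite -lee_fin; apply: le_trans small; exact: sup_disagree_ge.
have dis_cvg : chain_disagree (unif n) (QS n) (alpha * relaxation_time (QS n))
    (@dictator R eps n) @[n --> \oo] --> 2 * (c - 0).
  rewrite (_ : (fun n => _) = fun n => 2 * (dictator_var n - chain_cov (unif n) (QS n)
      (alpha * relaxation_time (QS n)) (@dictator R eps n))).
    apply: cvgM; first exact: cvg_cst.
    by apply: cvgB; [exact: dictator_var_cvg|exact: dictator_sensitive_star].
  apply/funext => n.
  rewrite (dictator_disagree _ (star_value_max nu)) (dictator_cov _ (star_value_max nu)).
  by ring.
have : 2 * (c - 0) <= c.
  by apply: (cvgr_to_le dis_cvg); near=> n; exact: dis_le.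
lra.
Unshelve. all: by end_near. Qed.

End Dictator.

Theorem theorem1p1 (R : realType) (nu : R) (hnu : 0 < nu) :
  (forall f : (forall n : nat, 'S_n.+1 -> bool),
     (noise_sensitive_complete nu f -> noise_sensitive_star nu f) /\
     (noise_stable_star nu f -> noise_stable_complete nu f)) /\
  (forall eps : R, 0 < eps -> eps < 1 ->
     [/\ noise_sensitive_star nu (dictator eps),
         ~ noise_sensitive_complete nu (dictator eps),
         noise_stable_complete nu (dictator eps)
       & ~ noise_stable_star nu (dictator eps)]).
Proof.
split=> [f|eps eps0 eps1].
  split; first exact: noise_sensitive_complete_star.
  exact: noise_stable_star_complete.
split.
- exact: dictator_sensitive_star.
- exact: dictator_not_sensitive_complete.
- exact: dictator_stable_complete.
- exact: dictator_not_stable_star.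
Qed.
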